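(* Work in ZF (Zermelo–Fraenkel set theory without the Axiom of Choice). The following assertion (A) is equivalent to Zorn's Lemma, hence also to the Axiom of Choice. (A) For every partially ordered set $\mathbf P=(P,\leq)$ with maximum $1$ and every $a \in P$: if both (i) $a \leq p$ for every maximal$_{<1}$ element $p$ of $\mathbf P$, and (iii) for every unbounded$_{<1}$ chain $(e_i)_{i\in I}$ in $\mathbf P$ and for every $i\in I$ there is $r\in P$ such that $r<1$, $a\leq r$ and $e_i\leq r$, then $a$ is a non-generator. The same holds if in (iii) ''for every $i \in I$'' is replaced by ''for some $i\in I$''.
   Context: Let $\mathbf P=(P,\leq)$ be a poset with maximum $1$ (not assumed to be a semilattice). For $a,e \in P$, ''$a \vee e = 1$'' means that there is no $p \in P$ such that $p<1$, $a \leq p$ and $e \leq p$. An element $a\in P$ is a non-generator if, for every $e \in P$, $a\vee e=1$ implies $e=1$. An element $p\in P$ is maximal$_{<1}$ if $p<1$ and there is no $q \in P$ such that $p<q<1$. A chain is a nonempty subset that is linearly ordered by the induced order; chains are denoted as families $(e_i)_{i\in I}$. A chain $(e_i)_{i \in I}$ in $\mathbf P$ is unbounded$_{<1}$ if $e_i<1$ for every $i\in I$ and there is no $p\in P$ such that $p<1$ and $e_i\leq p$ for every $i \in I$. A chain $(e_i)_{i\in I}$ in a poset $\mathbf Q$ is unbounded if there is no $q\in Q$ such that $e_i\leq q$ for every $i\in I$. Zorn's Lemma is the statement: for every nonempty poset $\mathbf Q$, either $\mathbf Q$ has a maximal element, or there is an unbounded chain in $\mathbf Q$. *)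

(* Defs.v *)
Set Implicit Arguments.
Unset Strict Implicit.

(** "Theorem of ZF" is rendered as "true in every model of first-order ZF".
    A theorem stated directly about Rocq types would not do, because the
    background logic may itself validate choice, whereas a model of first-order
    ZF may well violate it. *)

Record structure : Type := Structure {
  carrier :> Type;
  mem : carrier -> carrier -> Prop }.

Declare Scope zf_scope.
Delimit Scope zf_scope with zf.
Notation "x ∈ y" := (mem x y) (at level 70, no associativity) : zf_scope.
Open Scope zf_scope.

(** First-order formulas in the language of set theory, with de Bruijn indices:
    a quantifier binds index 0 and shifts the others.  They are needed because
    Separation and Replacement are schemas over formulas; letting them range
    over all of [M -> Prop] would give second-order ZF. *)

Inductive formula : Type :=
| FMem (i j : nat)
| FEq (i j : nat)
| FBot
| FImp (f g : formula)
| FAnd (f g : formula)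
| FOr (f g : formula)
| FAll (f : formula)
| FEx (f : formula).

Definition scons (T : Type) (x : T) (rho : nat -> T) (n : nat) : T :=
  match n with O => x | S k => rho k end.

Fixpoint sat (M : structure) (rho : nat -> M) (f : formula) : Prop :=
  match f with
  | FMem i j => rho i ∈ rho j
  | FEq i j => rho i = rho j
  | FBot => False
  | FImp g h => sat rho g -> sat rho h
  | FAnd g h => sat rho g /\ sat rho h
  | FOr g h => sat rho g \/ sat rho h
  | FAll g => forall x : M, sat (scons x rho) g
  | FEx g => exists x : M, sat (scons x rho) g
  end.

(** The assignment [rho] in the two schemas supplies the parameters. *)
Record ZF (M : structure) : Prop := {
  zf_extensionality : forall x y : M,
    (forall z : M, z ∈ x <-> z ∈ y) -> x = y;
  zf_foundation : forall x : M,
    (exists y : M, y ∈ x) ->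
    exists y : M, y ∈ x /\ ~ (exists z : M, z ∈ y /\ z ∈ x);
  zf_pairing : forall x y : M,
    exists z : M, forall w : M, w ∈ z <-> w = x \/ w = y;
  zf_union : forall x : M,
    exists u : M, forall w : M, w ∈ u <-> exists y : M, y ∈ x /\ w ∈ y;
  zf_powerset : forall x : M,
    exists p : M, forall w : M, w ∈ p <-> (forall z : M, z ∈ w -> z ∈ x);
  zf_infinity : exists x : M,
    (exists o : M, o ∈ x /\ forall w : M, ~ w ∈ o) /\
    (forall y : M, y ∈ x ->
       exists s : M, s ∈ x /\ forall w : M, w ∈ s <-> w ∈ y \/ w = y);
  zf_separation : forall (f : formula) (rho : nat -> M) (x : M),
    exists y : M, forall z : M, z ∈ y <-> z ∈ x /\ sat (scons z rho) f;
  zf_replacement : forall (f : formula) (rho : nat -> M) (x : M),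
    (forall u : M, u ∈ x ->
       exists! v : M, sat (scons u (scons v rho)) f) ->
    exists y : M, forall v : M,
      v ∈ y <-> exists u : M, u ∈ x /\ sat (scons u (scons v rho)) f }.

(** From here on all quantifiers range over the elements of [M], so every notion
    below is a first-order property of [M]. *)

Definition is_upair (M : structure) (z x y : M) : Prop :=
  forall w : M, w ∈ z <-> w = x \/ w = y.

(** Kuratowski: [p = {{x}, {x, y}}]. *)
Definition is_opair (M : structure) (p x y : M) : Prop :=
  exists s d : M, is_upair s x x /\ is_upair d x y /\ is_upair p s d.

(** The set [R] contains the ordered pair of [x] and [y]. *)
Definition rel (M : structure) (R x y : M) : Prop :=
  exists p : M, is_opair p x y /\ p ∈ R.

Definition subset (M : structure) (x y : M) : Prop :=
  forall z : M, z ∈ x -> z ∈ y.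

(** A poset of [M] is given by two elements of [M]: the underlying set [P] and
    the order relation [L], a set of ordered pairs. *)
Record is_poset (M : structure) (P L : M) : Prop := {
  poset_rel : forall p : M, p ∈ L ->
    exists x y : M, x ∈ P /\ y ∈ P /\ is_opair p x y;
  poset_refl : forall x : M, x ∈ P -> rel L x x;
  poset_antisym : forall x y : M, rel L x y -> rel L y x -> x = y;
  poset_trans : forall x y z : M, rel L x y -> rel L y z -> rel L x z }.

Definition lt (M : structure) (L x y : M) : Prop := rel L x y /\ x <> y.

Definition is_maximum (M : structure) (P L t : M) : Prop :=
  t ∈ P /\ forall x : M, x ∈ P -> rel L x t.

Definition is_maximal (M : structure) (Q L m : M) : Prop :=
  m ∈ Q /\ ~ (exists q : M, q ∈ Q /\ lt L m q).

(** A chain [(e_i)_{i in I}] is the set [C] of its elements, so that quantifying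
    over [i] in [I] amounts to quantifying over the elements of [C]. *)
Definition is_chain (M : structure) (P L C : M) : Prop :=
  subset C P /\ (exists e : M, e ∈ C) /\
  (forall x y : M, x ∈ C -> y ∈ C -> rel L x y \/ rel L y x).

Definition unbounded_chain (M : structure) (Q L C : M) : Prop :=
  is_chain Q L C /\
  ~ (exists q : M, q ∈ Q /\ forall e : M, e ∈ C -> rel L e q).

(** Below, [t] stands for the maximum [1] of the poset. *)

Definition join_is_top (M : structure) (P L t a e : M) : Prop :=
  ~ (exists p : M, p ∈ P /\ lt L p t /\ rel L a p /\ rel L e p).

Definition non_generator (M : structure) (P L t a : M) : Prop :=
  a ∈ P /\ forall e : M, e ∈ P -> join_is_top P L t a e -> e = t.

Definition maximal_lt_top (M : structure) (P L t p : M) : Prop :=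
  p ∈ P /\ lt L p t /\ ~ (exists q : M, q ∈ P /\ lt L p q /\ lt L q t).

Definition unbounded_lt_top_chain (M : structure) (P L t C : M) : Prop :=
  is_chain P L C /\ (forall e : M, e ∈ C -> lt L e t) /\
  ~ (exists p : M, p ∈ P /\ lt L p t /\ forall e : M, e ∈ C -> rel L e p).

Definition below_maximals (M : structure) (P L t a : M) : Prop :=
  forall p : M, maximal_lt_top P L t p -> rel L a p.

Definition chain_condition_every (M : structure) (P L t a : M) : Prop :=
  forall C : M, unbounded_lt_top_chain P L t C ->
  forall e : M, e ∈ C ->
  exists r : M, r ∈ P /\ lt L r t /\ rel L a r /\ rel L e r.

Definition chain_condition_some (M : structure) (P L t a : M) : Prop :=
  forall C : M, unbounded_lt_top_chain P L t C ->
  exists e : M, e ∈ C /\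
  exists r : M, r ∈ P /\ lt L r t /\ rel L a r /\ rel L e r.

Definition assertion_A (M : structure) : Prop :=
  forall P L t a : M, is_poset P L -> is_maximum P L t -> a ∈ P ->
  below_maximals P L t a -> chain_condition_every P L t a ->
  non_generator P L t a.

Definition assertion_A_some (M : structure) : Prop :=
  forall P L t a : M, is_poset P L -> is_maximum P L t -> a ∈ P ->
  below_maximals P L t a -> chain_condition_some P L t a ->
  non_generator P L t a.

Definition zorn_lemma (M : structure) : Prop :=
  forall Q L : M, is_poset Q L -> (exists q : M, q ∈ Q) ->
  (exists m : M, is_maximal Q L m) \/ (exists C : M, unbounded_chain Q L C).

Definition is_function_on (M : structure) (f X : M) : Prop :=
  (forall p : M, p ∈ f -> exists x y : M, x ∈ X /\ is_opair p x y) /\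
  (forall x : M, x ∈ X -> exists! y : M, rel f x y).

(** Every set of nonempty sets has a choice function. *)
Definition axiom_of_choice (M : structure) : Prop :=
  forall X : M, (forall x : M, x ∈ X -> exists y : M, y ∈ x) ->
  exists f : M, is_function_on f X /\
    forall x y : M, x ∈ X -> rel f x y -> y ∈ x.

(* Main.v *)
(** Zorn's lemma yields (A) by applying it to the poset of all [p] with
    [e <= p < 1].  Conversely, adjoin to a poset [Q] without maximal elements
    and unbounded chains a top and a coatom incomparable to [Q]: the coatom
    violates (A).  The equivalence of Zorn's lemma and choice is carried out
    inside [M], where only first-order definable subsets are available; from choice, the
    well-ordered chains of [Q] that follow a chosen strict upper bound at each
    step are pairwise comparable, so their union is one of them, yet could be
    prolonged. *)

Require Import Defs.
From Stdlib Require Import Classical.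

Set Implicit Arguments.
Unset Strict Implicit.

(** * Definability by first-order formulas, up to equivalence *)

(** The semantic form of "given by a formula whose variables are looked up in
    [env]"; working up to equivalence avoids writing de Bruijn formulas. *)
Definition definable (M : structure) (V : Type) (env : V -> nat -> M)
    (P : V -> Prop) : Prop :=
  exists f : formula, forall v : V, sat (env v) f <-> P v.

(** The semantic counterpart of a variable, the only kind of term in the language: one fixed index
    must work for every [v]. *)
Definition in_env (M : structure) (V : Type) (env : V -> nat -> M)
    (s : V -> M) : Prop :=
  exists i : nat, forall v : V, env v i = s v.

(** Passing under a quantifier: the bound element travels with the old variables as a pair and takes
    de Bruijn index 0. *)
Definition extend (M : structure) (V : Type) (env : V -> nat -> M)
    (p : V * M) : nat -> M :=
  scons (snd p) (env (fst p)).

Section Definability.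

Context (M : structure) (V : Type) (env : V -> nat -> M).

Lemma definable_mem (s t : V -> M) :
  in_env env s -> in_env env t -> definable env (fun v => s v ∈ t v).
Proof.
  intros [i Hi] [j Hj]. exists (FMem i j). intro v. simpl.
  rewrite Hi, Hj. tauto.
Qed.

Lemma definable_eq (s t : V -> M) :
  in_env env s -> in_env env t -> definable env (fun v => s v = t v).
Proof.
  intros [i Hi] [j Hj]. exists (FEq i j). intro v. simpl.
  rewrite Hi, Hj. tauto.
Qed.

Lemma definable_imp (P R : V -> Prop) :
  definable env P -> definable env R -> definable env (fun v => P v -> R v).
Proof.
  intros [f Hf] [g Hg]. exists (FImp f g). intro v. simpl.
  rewrite Hf, Hg. tauto.
Qed.

Lemma definable_and (P R : V -> Prop) :
  definable env P -> definable env R -> definable env (fun v => P v /\ R v).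
Proof.
  intros [f Hf] [g Hg]. exists (FAnd f g). intro v. simpl.
  rewrite Hf, Hg. tauto.
Qed.

Lemma definable_or (P R : V -> Prop) :
  definable env P -> definable env R -> definable env (fun v => P v \/ R v).
Proof.
  intros [f Hf] [g Hg]. exists (FOr f g). intro v. simpl.
  rewrite Hf, Hg. tauto.
Qed.

Lemma definable_not (P : V -> Prop) :
  definable env P -> definable env (fun v => ~ P v).
Proof.
  intros [f Hf]. exists (FImp f FBot). intro v. simpl.
  rewrite Hf. tauto.
Qed.

Lemma definable_iff (P R : V -> Prop) :
  definable env P -> definable env R -> definable env (fun v => P v <-> R v).
Proof.
  intros HP HR. apply definable_and; apply definable_imp; assumption.
Qed.

Lemma definable_all (P : V -> M -> Prop) :
  definable (extend env) (fun p => P (fst p) (snd p)) ->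
  definable env (fun v => forall x : M, P v x).
Proof.
  intros [f Hf]. exists (FAll f). intro v. simpl.
  split; intros H x; apply (Hf (v, x)); apply H.
Qed.

Lemma definable_ex (P : V -> M -> Prop) :
  definable (extend env) (fun p => P (fst p) (snd p)) ->
  definable env (fun v => exists x : M, P v x).
Proof.
  intros [f Hf]. exists (FEx f). intro v. simpl.
  split; intros [x H]; exists x; apply (Hf (v, x)); exact H.
Qed.

End Definability.

Ltac find_in_env n :=
  first [ exists n; intro; reflexivity | find_in_env (S n) ].

(** Builds the formula by following the shape of the property; defined notions are unfolded only
    when no other case applies. *)
Ltac prove_definable :=
  lazymatch goal with
  | |- definable _ (fun _ => _ /\ _) => apply definable_and; prove_definable
  | |- definable _ (fun _ => _ \/ _) => apply definable_or; prove_definable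
  | |- definable _ (fun _ => _ <-> _) => apply definable_iff; prove_definable
  | |- definable _ (fun _ => ~ _) => apply definable_not; prove_definable
  | |- definable _ (fun _ => _ ∈ _) => apply definable_mem; find_in_env 0
  | |- definable _ (fun _ => _ = _) => apply definable_eq; find_in_env 0
  | |- definable _ (fun _ => exists _, _) =>
      apply definable_ex; cbv beta; prove_definable
  | |- definable _ (fun _ => _ -> _) =>
      first [ apply definable_imp; prove_definable
            | apply definable_all; cbv beta; prove_definable ]
  | |- _ => first [ apply definable_all; cbv beta; prove_definable
                  | progress unfold lt, subset, rel, is_opair, is_upair;
                    prove_definable ]
  end.

(** * Elementary set theory inside a model of ZF *)

Section SetTheory.

Context (M : structure) (HM : ZF M).

(** [rho] lists the parameters of the definable property [P]. *)
Lemma separation (rho : nat -> M) (P : M -> Prop) (x : M) :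
  definable (fun z => scons z rho) P ->
  exists y : M, forall z : M, z ∈ y <-> z ∈ x /\ P z.
Proof.
  intros [f Hf]. destruct (zf_separation HM f rho x) as [y Hy].
  exists y. intro z. rewrite Hy, Hf. tauto.
Qed.

(** Foundation applied to the singleton of [x]. Consequently every set is itself an object outside
    itself, a cheap source of fresh elements. *)
Lemma not_mem_self (x : M) : ~ x ∈ x.
Proof.
  intro Hx. destruct (zf_pairing HM x x) as [s Hs].
  destruct (zf_foundation HM (x := s)) as (y & Hy & Hmin).
  { exists x. apply Hs. tauto. }
  apply Hs in Hy. apply Hmin. exists x. split.
  - destruct Hy as [-> | ->]; exact Hx.
  - apply Hs. tauto.
Qed.

Lemma binary_union (x y : M) :
  exists u : M, forall w : M, w ∈ u <-> w ∈ x \/ w ∈ y.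
Proof.
  destruct (zf_pairing HM x y) as [d Hd].
  destruct (zf_union HM d) as [u Hu].
  exists u. intro w. rewrite Hu. split.
  - intros (z & Hz & Hw). apply Hd in Hz. destruct Hz as [-> | ->]; tauto.
  - intros [H | H]; [exists x | exists y]; rewrite Hd; tauto.
Qed.

Lemma adjoin (x a : M) :
  exists u : M, forall w : M, w ∈ u <-> w ∈ x \/ w = a.
Proof.
  destruct (zf_pairing HM a a) as [s Hs].
  destruct (binary_union x s) as [u Hu].
  exists u. intro w. rewrite Hu, Hs. tauto.
Qed.

Lemma opair_exists (x y : M) : exists p : M, is_opair p x y.
Proof.
  destruct (zf_pairing HM x x) as [s Hs], (zf_pairing HM x y) as [d Hd].
  destruct (zf_pairing HM s d) as [p Hp].
  exists p, s, d. auto.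
Qed.

Lemma upair_unique (p q x y : M) : is_upair p x y -> is_upair q x y -> p = q.
Proof.
  intros Hp Hq. apply (zf_extensionality HM). intro w.
  rewrite (Hp w), (Hq w). tauto.
Qed.

Lemma opair_unique (p q x y : M) : is_opair p x y -> is_opair q x y -> p = q.
Proof.
  intros (s & d & Hs & Hd & Hp) (s' & d' & Hs' & Hd' & Hq).
  rewrite (upair_unique Hs' Hs), (upair_unique Hd' Hd) in Hq.
  exact (upair_unique Hp Hq).
Qed.

Lemma upair_inj (p x y u v : M) :
  is_upair p x y -> is_upair p u v -> (x = u /\ y = v) \/ (x = v /\ y = u).
Proof.
  intros H H'.
  assert (Hx : x = u \/ x = v) by (apply H', H; tauto).
  assert (Hy : y = u \/ y = v) by (apply H', H; tauto).
  assert (Hu : u = x \/ u = y) by (apply H, H'; tauto).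
  assert (Hv : v = x \/ v = y) by (apply H, H'; tauto).
  intuition congruence.
Qed.

Lemma opair_inj (p x y u v : M) :
  is_opair p x y -> is_opair p u v -> x = u /\ y = v.
Proof.
  intros (s & d & Hs & Hd & Hp) (s' & d' & Hs' & Hd' & Hq).
  destruct (upair_inj Hp Hq) as [[-> ->] | [-> ->]].
  - assert (E := upair_inj Hs Hs'). assert (E' := upair_inj Hd Hd').
    intuition congruence.
  (* In the crossed case each singleton equals the other side's unordered pair, which forces all
     four entries to coincide. *)
  - assert (E := upair_inj Hs Hd'). assert (E' := upair_inj Hd Hs').
    intuition congruence.
Qed.

Lemma rel_of_mem (R p x y : M) : is_opair p x y -> rel R x y -> p ∈ R.
Proof.
  intros Hp (q & Hq & HqR). rewrite (opair_unique Hp Hq). exact HqR.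
Qed.

(** The environment of [P] contains an unused entry, the pair [z] itself. *)
Lemma relation_exists (rho : nat -> M) (P : M -> M -> Prop) (X : M) :
  definable (extend (extend (fun z => scons z rho)))
    (fun v => P (snd (fst v)) (snd v)) ->
  exists R : M,
    (forall p : M, p ∈ R ->
       exists x y : M, x ∈ X /\ y ∈ X /\ is_opair p x y) /\
    (forall x y : M, rel R x y <-> x ∈ X /\ y ∈ X /\ P x y).
Proof.
  intro HP.
  (* A Kuratowski pair over [X] is a set of subsets of [X], so the double power set contains all of
     them. Conversely, a pair lying there has both entries in [X]. *)
  destruct (zf_powerset HM X) as [X1 HX1].
  destruct (zf_powerset HM X1) as [X2 HX2].
  destruct (@separation rho
    (fun z => exists x y : M, is_opair z x y /\ P x y) X2) as [R HR].
  { apply definable_ex, definable_ex, definable_and; [prove_definable|exact HP]. }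
  exists R.
  assert (Hmem : forall p x y : M, p ∈ R -> is_opair p x y -> x ∈ X /\ y ∈ X).
  { intros p x y HpR (s & d & Hs & Hd & Hp). apply HR in HpR.
    assert (Hdp : d ∈ X1) by (apply (proj1 (HX2 p)); [tauto|apply Hp; tauto]).
    split; apply (proj1 (HX1 d) Hdp), Hd; tauto. }
  split.
  - intros p HpR. assert (H := HpR). apply HR in H.
    destruct H as (_ & x & y & Hp & _).
    exists x, y. specialize (Hmem p x y HpR Hp). tauto.
  - intros x y. split.
    + intros (p & Hp & HpR). assert (H := HpR). apply HR in H.
      destruct H as (_ & x' & y' & Hp' & HPxy).
      destruct (opair_inj Hp Hp') as [-> ->].
      specialize (Hmem p x' y' HpR Hp'). tauto.
    + intros (Hx & Hy & HPxy). destruct (opair_exists x y) as [p Hp].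
      exists p. split; [exact Hp|]. apply HR. split.
      * apply HX2. destruct Hp as (s & d & Hs & Hd & Hp).
        intros w Hw. apply HX1. intros z Hz.
        apply Hp in Hw. destruct Hw as [-> | ->];
          [apply Hs in Hz | apply Hd in Hz]; destruct Hz as [-> | ->]; auto.
      * exists x, y. auto.
Qed.

Lemma poset_mem (P L x y : M) :
  is_poset P L -> rel L x y -> x ∈ P /\ y ∈ P.
Proof.
  intros HP (p & Hp & HpL).
  destruct (poset_rel HP HpL) as (x' & y' & Hx & Hy & Hp').
  destruct (opair_inj Hp Hp') as [-> ->]. auto.
Qed.

(** * Zorn's lemma and the two forms of (A) *)

Lemma zorn_assertion_A_some : zorn_lemma M -> assertion_A_some M.
Proof.
  intros HZ P L t a HP [Ht Htop] Ha Hmax Hchain. split; [exact Ha|].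
  intros e He Hjoin. apply NNPP. intro Het.
  (* [Q] is the interval of all [p] with [e] below [p] and [p] different from [t], under the
     restricted order [K]. *)
  destruct (@separation (scons e (scons t (fun _ => L)))
    (fun p => rel L e p /\ p <> t) P) as [Q HQ]; [prove_definable|].
  destruct (@relation_exists (fun _ => L) (fun x y => rel L x y) Q)
    as (K & HKpair & HK); [prove_definable|].
  destruct (HZ Q K) as [(m & HmQ & Hm) | (C & (HCQ & Hne & HCtot) & HCunb)].
  - split.
    + exact HKpair.
    + intros x Hx. apply HK. split; [|split]; auto.
      apply (poset_refl HP). apply HQ in Hx. tauto.
    + intros x y Hxy Hyx. apply HK in Hxy, Hyx.
      apply (poset_antisym HP); tauto.
    + intros x y z Hxy Hyz. apply HK in Hxy, Hyz. apply HK.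
      split; [|split]; try tauto. apply (poset_trans HP) with y; tauto.
  - exists e. apply HQ. split; [exact He|]. split; [|exact Het].
    exact (poset_refl HP He).
  (* Anything above [m] is above [e], so [m] is maximal below [t] in all of [P]. By (i) it bounds
     both [a] and [e], against [Hjoin]. *)
  - assert (HmQ' := HmQ). apply HQ in HmQ'. destruct HmQ' as (HmP & Hem & Hmt).
    apply Hjoin. exists m. split; [exact HmP|].
    assert (Hlt : lt L m t) by (split; auto).
    split; [exact Hlt|]. split; [|exact Hem].
    apply Hmax. split; [exact HmP|]. split; [exact Hlt|].
    intros (q & HqP & [Hmq Hne] & [Hqt Hqt']). apply Hm.
    assert (HqQ : q ∈ Q).
    { apply HQ. split; [exact HqP|]. split; [|exact Hqt'].
      exact (poset_trans HP Hem Hmq). }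
    exists q. split; [exact HqQ|]. split; [apply HK; auto|exact Hne].
  (* A bound of [C] below [t] lies above a member of [C], hence above [e], hence in [Q]; so [C] is
     unbounded below [t] in [P] too. The element [r] given by (iii) lies above [c], hence above
     [e]. *)
  - destruct (Hchain C) as (c & Hc & r & Hr & Hrt & Har & Hcr).
    + split; [split; [|split]|split].
      * intros x Hx. apply HCQ, HQ in Hx. tauto.
      * exact Hne.
      * intros x y Hx Hy.
        destruct (HCtot x y Hx Hy) as [H | H]; apply HK in H; tauto.
      * intros x Hx. apply HCQ, HQ in Hx. split; [apply Htop|]; tauto.
      * intros (p & HpP & [Hpt Hpt'] & Hbound). apply HCunb.
        assert (HpQ : p ∈ Q).
        { destruct Hne as [c Hc]. apply HQ. split; [exact HpP|].
          split; [|exact Hpt']. apply (poset_trans HP) with c; [|auto].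
          apply HCQ, HQ in Hc. tauto. }
        exists p. split; [exact HpQ|]. intros x Hx. apply HK. auto.
    + apply Hjoin. exists r. do 3 (split; [assumption|]).
      apply (poset_trans HP) with c; [|exact Hcr].
      apply HCQ, HQ in Hc. tauto.
Qed.

(** Chains are nonempty, so the condition on every member implies the one on some member: the
    variant has the weaker hypothesis and is the stronger assertion. *)
Lemma assertion_A_some_every : assertion_A_some M -> assertion_A M.
Proof.
  intros HA P L t a HP Ht Ha Hmax Hchain. apply (HA P L t a); auto.
  intros C HC. destruct (proj1 (proj2 (proj1 HC))) as [e He]. exists e. split; [exact He|].
  exact (Hchain C HC e He).
Qed.

Lemma assertion_A_zorn : assertion_A M -> zorn_lemma M.
Proof.
  intros HA Q L HQ [q0 Hq0]. apply NNPP. intro Hnot.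
  assert (Hnomax : ~ exists m : M, is_maximal Q L m) by tauto.
  assert (Hbounded : ~ exists C : M, unbounded_chain Q L C) by tauto.
  clear Hnot.
  assert (Hfresh : forall X : M, exists x : M, ~ x ∈ X)
    by (intro X; exists X; apply not_mem_self).
  destruct (Hfresh Q) as [a Ha].
  destruct (adjoin Q a) as [U HU].
  destruct (Hfresh U) as [t Ht].
  destruct (adjoin U t) as [P HP].
  assert (HtQ : ~ t ∈ Q) by (intro H; apply Ht, HU; auto).
  assert (Hat : a <> t) by (intros <-; apply Ht, HU; auto).
  assert (HPcases : forall x : M, x ∈ P <-> x ∈ Q \/ x = a \/ x = t)
    by (intro x; rewrite HP, HU; tauto).
  clear U HU Ht HP.
  (* The order [K] extends [L], puts [t] above everything, and relates [a] only to itself and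
     [t]. *)
  destruct (@relation_exists (scons L (scons a (fun _ => t)))
    (fun x y => rel L x y \/ (x = a /\ y = a) \/ y = t) P)
    as (K & HKpair & HK); [prove_definable|].
  assert (HLQ : forall x y : M, rel L x y -> x ∈ Q /\ y ∈ Q)
    by (intros x y; apply poset_mem; exact HQ).
  assert (Hcmpa : forall x : M, rel K a x -> x = a \/ x = t).
  { intros x H. apply HK in H. destruct H as (_ & _ & [H | H]); [|tauto].
    apply HLQ in H. tauto. }
  assert (Hcmpa' : forall x : M, rel K x a -> x = a).
  { intros x H. apply HK in H. destruct H as (_ & _ & [H | [H | H]]);
      [|tauto|congruence].
    apply HLQ in H. tauto. }
  assert (HQK : forall x y : M, x ∈ Q -> y ∈ Q -> (rel K x y <-> rel L x y)).
  { intros x y Hx Hy. rewrite HK, !HPcases. split; [|tauto].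
    intros (_ & _ & [H | [[H _] | H]]); [exact H| |]; subst; tauto. }
  assert (HKt : forall x : M, x ∈ P -> rel K x t).
  { intros x Hx. apply HK. split; [exact Hx|]. rewrite HPcases. auto. }
  assert (HaP : a ∈ P) by (apply HPcases; auto).
  assert (HKaa : rel K a a) by (apply HK; auto 6).
  assert (HK_poset : is_poset P K).
  { split.
    - exact HKpair.
    - intros x Hx. apply HK. split; [exact Hx|]. split; [exact Hx|].
      apply HPcases in Hx. destruct Hx as [Hx | [-> | ->]]; auto.
      left. exact (poset_refl HQ Hx).
    - intros x y Hxy Hyx. apply HK in Hxy, Hyx.
      destruct Hxy as (_ & _ & [Hxy | [[-> ->] | ->]]); auto.
      + destruct Hyx as (_ & _ & [Hyx | [[-> ->] | ->]]); auto.
        * exact (poset_antisym HQ Hxy Hyx).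
        * apply HLQ in Hxy. tauto.
      + destruct Hyx as (_ & _ & [Hyx | [[E _] | ->]]); auto.
        * apply HLQ in Hyx. tauto.
        * congruence.
    - intros x y z Hxy Hyz. apply HK in Hxy, Hyz. apply HK.
      destruct Hxy as (Hx & _ & Hxy), Hyz as (_ & Hz & Hyz).
      split; [exact Hx|]. split; [exact Hz|].
      destruct Hyz as [Hyz | [[-> ->] | ->]]; [|tauto|tauto].
      destruct Hxy as [Hxy | [[-> ->] | ->]].
      + left. exact (poset_trans HQ Hxy Hyz).
      + apply HLQ in Hyz. tauto.
      + apply HLQ in Hyz. tauto. }
  destruct (HA P K t a) as [_ Hgen].
  - exact HK_poset.
  - split; [apply HPcases; auto|exact HKt].
  - exact HaP.
  (* Condition (i): no element of [Q] is maximal below [t], so [a] is the only candidate. *)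
  - intros p (HpP & [_ Hpt] & Hpmax).
    apply HPcases in HpP. destruct HpP as [HpQ | [-> | ->]];
      [|exact HKaa|tauto].
    destruct Hnomax. exists p. split; [exact HpQ|].
    intros (q & HqQ & Hpq & Hne). apply Hpmax.
    assert (HqP : q ∈ P) by (apply HPcases; auto).
    exists q. split; [exact HqP|]. split; split; auto.
    + apply HQK; auto.
    + intros ->. auto.
  (* Condition (iii) is vacuous: a chain below [t] through [a] is bounded by [a], and any other one
     lies in [Q] and is bounded there. *)
  - intros C ((HCP & HCne & HCtot) & HClt & HCunb). exfalso.
    destruct (classic (a ∈ C)) as [HaC | HaC].
    + apply HCunb. exists a. split; [exact HaP|].
      split; [split; auto|]. intros e He.
      destruct (HCtot a e HaC He) as [H | H].
      * destruct (Hcmpa e H) as [-> | ->]; [exact HKaa|].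
        destruct (HClt t He). tauto.
      * exact H.
    + assert (HCQ : subset C Q).
      { intros e He. assert (H := HCP e He). apply HPcases in H.
        destruct H as [H | [-> | ->]]; [exact H|tauto|].
        destruct (HClt t He). tauto. }
      apply Hbounded. exists C. split; [split; [|split]|].
      * exact HCQ.
      * exact HCne.
      * intros x y Hx Hy. rewrite <- !HQK; auto.
      * intros (q & HqQ & Hq). apply HCunb.
        assert (HqP : q ∈ P) by (apply HPcases; auto).
        exists q. split; [exact HqP|]. split.
        -- split; [auto|]. intros ->. auto.
        -- intros e He. apply HQK; auto.
  (* Only [t] lies above both [a] and [q0], so the non-generator property forces [q0 = t], although
     [t] is outside [Q]. *)
  - apply HtQ. rewrite <- (Hgen q0); [exact Hq0|apply HPcases; auto|].
    intros (p & HpP & [_ Hpt] & Hap & Hqp).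
    destruct (Hcmpa p Hap) as [-> | ->]; [|tauto].
    apply Hcmpa' in Hqp. congruence.
Qed.

(** * Choice from Zorn's lemma *)

Lemma zorn_choice : zorn_lemma M -> axiom_of_choice M.
Proof.
  (* Zorn's lemma is applied to the partial choice functions on [X], ordered by inclusion; a maximal
     one is total. They are the functional subsets of [W], the set of pairs of some [x] in [X] with
     an element of [x]. *)
  intros HZ X HX.
  destruct (zf_union HM X) as [Y HY].
  destruct (binary_union X Y) as [Z HZ'].
  destruct (@relation_exists (fun _ => X) (fun x y => x ∈ X /\ y ∈ x) Z)
    as (W & HWpair & HW); [prove_definable|].
  assert (HWrel : forall x y : M, rel W x y <-> x ∈ X /\ y ∈ x).
  { intros x y. rewrite HW, !HZ', !HY. split; [tauto|].
    intros [Hx Hy]. split; [auto|]. split; [|auto].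
    right. exists x. auto. }
  assert (Hsub : forall g x y : M, subset g W -> rel g x y -> x ∈ X /\ y ∈ x).
  { intros g x y Hg (p & Hp & Hpg). apply HWrel. exists p. auto. }
  clear Y HY HZ' HW.
  destruct (zf_powerset HM W) as [PW HPW].
  destruct (@separation (fun _ => X)
    (fun g => forall x y z : M, rel g x y -> rel g x z -> y = z) PW)
    as [Q HQ]; [prove_definable|].
  destruct (@relation_exists (fun _ => X) (fun g h => subset g h) Q)
    as (L & HLpair & HL); [prove_definable|].
  destruct (HZ Q L) as [(f & HfQ & Hf) | (C & (HCQ & Hne & HCtot) & HCunb)].
  - split.
    + exact HLpair.
    + intros g Hg. apply HL. split; [|split]; auto. intros p Hp. exact Hp.
    + intros g h Hgh Hhg. apply HL in Hgh, Hhg.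
      destruct Hgh as (_ & _ & Hgh), Hhg as (_ & _ & Hhg).
      apply (zf_extensionality HM). intro p. split; auto.
    + intros g h k Hgh Hhk. apply HL in Hgh, Hhk. apply HL.
      destruct Hgh as (Hg & _ & Hgh), Hhk as (_ & Hk & Hhk).
      split; [exact Hg|]. split; [exact Hk|]. intros p Hp. auto.
  - destruct (@separation (fun _ => X) (fun _ => False) X)
      as [o Ho].
    { exists FBot. simpl. tauto. }
    exists o. apply HQ. split.
    + apply HPW. intros p Hp. apply Ho in Hp. tauto.
    + intros x y z (p & _ & Hp). apply Ho in Hp. tauto.
  - assert (H := HfQ). apply HQ in H. destruct H as [HfW Hfun].
    assert (HfW' := proj1 (HPW f) HfW).
    exists f. split; [split|].
    + intros p Hp. destruct (HWpair p (HfW' p Hp)) as (x & y & _ & _ & Hxy).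
      exists x, y. split; [|exact Hxy].
      apply (Hsub f x y HfW'). exists p. auto.
    + intros x Hx. destruct (classic (exists y : M, rel f x y)) as [[y Hy] | Hno].
      (* Uniqueness of the value is membership of [f] in [Q]. If there is no value at [x], adjoining
         a pair of [x] with one of its elements extends [f] properly. *)
      * exists y. split; [exact Hy|]. intro z. apply Hfun. exact Hy.
      * exfalso. destruct (HX x Hx) as [y Hy].
        destruct (opair_exists x y) as [p Hp].
        destruct (adjoin f p) as [h Hh].
        assert (Hhrel : forall u v : M,
                  rel h u v -> rel f u v \/ (u = x /\ v = y)).
        { intros u v (q & Hq & Hqh). apply Hh in Hqh.
          destruct Hqh as [Hqf | ->].
          - left. exists q. auto.
          - right. destruct (opair_inj Hp Hq) as [-> ->]. auto. }
        assert (HhQ : h ∈ Q).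
        { apply HQ. split.
          - apply HPW. intros q Hq. apply Hh in Hq. destruct Hq as [Hq | ->].
            + auto.
            + apply (rel_of_mem Hp), HWrel. auto.
          - intros u v w Huv Huw. apply Hhrel in Huv, Huw.
            destruct Huv as [Huv | [-> ->]], Huw as [Huw | [Eu Ew]].
            + exact (Hfun u v w Huv Huw).
            + subst. destruct Hno. eauto.
            + destruct Hno. eauto.
            + auto. }
        apply Hf. exists h. split; [exact HhQ|]. split.
        -- apply HL. split; [exact HfQ|]. split; [exact HhQ|].
           intros q Hq. apply Hh. auto.
        -- intros ->. apply Hno. exists y. exists p. split; [exact Hp|].
           apply Hh. auto.
    + intros x y _ Hxy. exact (proj2 (Hsub f x y HfW' Hxy)).
  (* The union of the chain is an upper bound; it is functional because any two of its pairs already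
     lie in a common member of [C]. *)
  - exfalso. destruct (zf_union HM C) as [U HU]. apply HCunb.
    assert (HUQ : U ∈ Q).
    { apply HQ. split.
      - apply HPW. intros p Hp. apply HU in Hp. destruct Hp as (g & Hg & Hp).
        apply HCQ, HQ in Hg. destruct Hg as [Hg _].
        exact (proj1 (HPW g) Hg p Hp).
      - intros x y z (p & Hp & HpU) (q & Hq & HqU).
        apply HU in HpU, HqU.
        destruct HpU as (g & Hg & Hpg), HqU as (h & Hh & Hqh).
        assert (Hcommon : exists k : M, k ∈ C /\ p ∈ k /\ q ∈ k).
        { destruct (HCtot g h Hg Hh) as [H | H];
            apply HL in H; destruct H as (_ & _ & H);
            [exists h | exists g]; auto. }
        destruct Hcommon as (k & Hk & Hpk & Hqk).
        apply HCQ, HQ in Hk. destruct Hk as [_ Hk].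
        apply (Hk x); [exists p | exists q]; auto. }
    exists U. split; [exact HUQ|]. intros g Hg. apply HL.
    split; [auto|]. split; [exact HUQ|]. intros p Hp. apply HU. eauto.
Qed.

(** * Zorn's lemma from choice, by well-ordered chains of chosen bounds *)

Lemma lt_asym (P L x y : M) : is_poset P L -> lt L x y -> ~ rel L y x.
Proof.
  intros HP [Hxy Hne] Hyx. exact (Hne (poset_antisym HP Hxy Hyx)).
Qed.

Lemma lt_trans (P L x y z : M) :
  is_poset P L -> lt L x y -> lt L y z -> lt L x z.
Proof.
  intros HP Hxy Hyz. split.
  - exact (poset_trans HP (proj1 Hxy) (proj1 Hyz)).
  - intros ->. exact (lt_asym HP Hxy (proj1 Hyz)).
Qed.

Definition total_on (L A : M) : Prop :=
  forall x y : M, x ∈ A -> y ∈ A -> rel L x y \/ rel L y x.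

(** [G C x] reads: [x] is the chosen strict upper bound of [C]. *)
Definition conforming (Q L : M) (G : M -> M -> Prop) (A : M) : Prop :=
  subset A Q /\ total_on L A /\
  (forall B : M, subset B A -> (exists b : M, b ∈ B) ->
     exists m : M, m ∈ B /\ forall b : M, b ∈ B -> rel L m b) /\
  (forall x : M, x ∈ A ->
     forall S : M, (forall y : M, y ∈ S <-> y ∈ A /\ lt L y x) -> G S x).

(** Compares initial segments as literally equal sets, so no order isomorphisms or ordinals are
    needed. The notion is symmetric in [A] and [B]. *)
Definition agree_up_to (L A B x : M) : Prop :=
  x ∈ A /\ x ∈ B /\ forall w : M, lt L w x -> (w ∈ A <-> w ∈ B).

Section Conforming.

Context (Q L : M) (HQ : is_poset Q L) (G : M -> M -> Prop).

(** [a] is the least element of [A] without agreement. Its predecessors in [A] are exactly the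
    agreement points, a description of [S] that mentions no [a] and is symmetric in [A] and [B]. *)
Lemma first_disagreement (A B : M) :
  conforming Q L G A -> ~ (forall x : M, x ∈ A -> agree_up_to L A B x) ->
  exists a S : M, a ∈ A /\ ~ agree_up_to L A B a /\ G S a /\
    forall w : M,
      (w ∈ S <-> agree_up_to L A B w) /\ (w ∈ S <-> w ∈ A /\ lt L w a).
Proof.
  intros (HAQ & HAtot & HAwf & HAG) Hnot.
  destruct (@separation (scons A (scons B (fun _ => L)))
    (fun x => ~ (x ∈ A /\ x ∈ B /\ forall w : M, lt L w x -> (w ∈ A <-> w ∈ B)))
    A) as [D HD]; [prove_definable|].
  destruct (HAwf D) as (a & HaD & Hmin).
  { intros x Hx. apply HD in Hx. tauto. }
  { apply not_all_ex_not in Hnot. destruct Hnot as [x Hx].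
    apply imply_to_and in Hx. exists x. apply HD. exact Hx. }
  apply HD in HaD. destruct HaD as [HaA Ha].
  destruct (@separation (scons a (fun _ => L)) (fun y => lt L y a) A)
    as [S HS]; [prove_definable|].
  exists a, S. split; [exact HaA|]. split; [exact Ha|].
  split; [exact (HAG a HaA S HS)|].
  intro w. split; [|exact (HS w)]. rewrite HS. split.
  - intros [HwA Hwa]. apply NNPP. intro Hw.
    apply (lt_asym HQ Hwa), Hmin, HD. auto.
  (* If an agreement point [w] were above [a], agreement would pass down from [w] to [a]. *)
  - intros (HwA & HwB & Hw). split; [exact HwA|].
    assert (Hne : w <> a) by (intros ->; apply Ha; split; auto).
    destruct (HAtot w a HwA HaA) as [H | H]; [split; auto|].
    exfalso. assert (Haw : lt L a w) by (split; auto).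
    apply Ha. split; [exact HaA|]. split; [apply Hw; auto|].
    intros v Hv. apply Hw. exact (lt_trans HQ Hv Haw).
Qed.

Context (G_functional : forall C x y : M, G C x -> G C y -> x = y).

(** Otherwise each set has a first disagreement with the other, and both have the agreement points
    as predecessor set. Functionality of [G] identifies the two, and the common element is then an
    agreement point. *)
Lemma conforming_comparable (A B : M) :
  conforming Q L G A -> conforming Q L G B ->
  (forall x : M, x ∈ A -> agree_up_to L A B x) \/
  (forall x : M, x ∈ B -> agree_up_to L A B x).
Proof.
  intros HA HB.
  assert (Hsym : forall x : M, agree_up_to L A B x <-> agree_up_to L B A x).
  { intro x. split; intros (H1 & H2 & H3); split; [|split| |split]; auto;
      intros w Hw; specialize (H3 w Hw); tauto. }
  apply NNPP. intro Hnot. apply not_or_and in Hnot. destruct Hnot as [HnA HnB].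
  destruct (first_disagreement HA HnA) as (a & S & Ha & Hna & HGa & HS).
  destruct (@first_disagreement B A) as (b & T & Hb & Hnb & HGb & HT); [auto| |].
  { intro H. apply HnB. intros x Hx. apply Hsym. auto. }
  assert (E : S = T).
  { apply (zf_extensionality HM). intro w.
    rewrite (proj1 (HS w)), (proj1 (HT w)). apply Hsym. }
  subst T. assert (E := G_functional HGa HGb). subst b.
  apply Hna. split; [exact Ha|]. split; [exact Hb|].
  intros w Hw. specialize (HS w). specialize (HT w). tauto.
Qed.

Lemma conforming_initial (A B x w : M) :
  conforming Q L G A -> conforming Q L G B ->
  x ∈ A -> w ∈ B -> lt L w x -> w ∈ A.
Proof.
  intros HA HB Hx Hw Hwx.
  destruct (conforming_comparable HA HB) as [H | H].
  - destruct (H x Hx) as (_ & _ & Hagree). apply Hagree; auto.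
  - destruct (H w Hw) as [HwA _]. exact HwA.
Qed.

(** Every member of [K] is an initial segment of the union, so predecessor sets and minima can be
    computed inside one member. *)
Lemma conforming_union (K U : M) :
  (forall A : M, A ∈ K -> conforming Q L G A) ->
  (forall x : M, x ∈ U <-> exists A : M, A ∈ K /\ x ∈ A) ->
  conforming Q L G U.
Proof.
  intros HK HU.
  assert (Hinit : forall A x w : M, A ∈ K -> x ∈ A -> w ∈ U -> lt L w x -> w ∈ A).
  { intros A x w HA Hx Hw Hwx. apply HU in Hw. destruct Hw as (B & HB & Hw).
    apply (@conforming_initial A B x w); auto. }
  assert (HUtot : total_on L U).
  { intros x y Hx Hy. apply HU in Hx, Hy.
    destruct Hx as (A & HA & Hx), Hy as (B & HB & Hy).
    destruct (conforming_comparable (HK A HA) (HK B HB)) as [H | H].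
    - destruct (HK B HB) as (_ & HBtot & _).
      destruct (H x Hx) as (_ & Hx' & _). auto.
    - destruct (HK A HA) as (_ & HAtot & _).
      destruct (H y Hy) as (Hy' & _ & _). auto. }
  split; [|split; [|split]].
  - intros x Hx. apply HU in Hx. destruct Hx as (A & HA & Hx).
    destruct (HK A HA) as [HAQ _]. auto.
  - exact HUtot.
  - intros B HBU [b Hb]. assert (HbU := HBU b Hb). apply HU in HbU.
    destruct HbU as (A & HA & HbA).
    destruct (HK A HA) as (_ & _ & HAwf & _).
    (* The least element of [B] within [A] is least in all of [B], since anything smaller in [B]
       would also lie in [A]. *)
    destruct (@separation (fun _ => B) (fun x => x ∈ B) A) as [D HD];
      [prove_definable|].
    destruct (HAwf D) as (m & HmD & Hm).
    { intros x Hx. apply HD in Hx. tauto. }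
    { exists b. apply HD. auto. }
    apply HD in HmD. destruct HmD as [HmA HmB].
    exists m. split; [exact HmB|]. intros x Hx.
    destruct (HUtot m x) as [H | H]; auto.
    destruct (classic (x = m)) as [-> | Hne]; [exact H|].
    apply Hm, HD. split; [|exact Hx].
    apply (@Hinit A m x); auto. split; auto.
  - intros x Hx S HS. apply HU in Hx. destruct Hx as (A & HA & Hx).
    destruct (HK A HA) as (_ & _ & _ & HAG). apply (HAG x Hx).
    intro y. rewrite HS. split; intros [Hy Hyx]; (split; [|exact Hyx]).
    + apply (@Hinit A x y); auto.
    + apply HU. exists A. auto.
Qed.

(** The new element is on top: old predecessor sets stay the same, and that of [x] is [A] itself. *)
Lemma conforming_adjoin (A V x : M) :
  conforming Q L G A -> G A x -> x ∈ Q ->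
  (forall y : M, y ∈ A -> lt L y x) ->
  (forall y : M, y ∈ V <-> y ∈ A \/ y = x) ->
  conforming Q L G V.
Proof.
  intros (HAQ & HAtot & HAwf & HAG) HGx HxQ Hx HV.
  assert (Hxx : rel L x x) by exact (poset_refl HQ HxQ).
  split; [|split; [|split]].
  - intros y Hy. apply HV in Hy. destruct Hy as [Hy | ->]; auto.
  - intros y z Hy Hz. apply HV in Hy, Hz.
    destruct Hy as [Hy | ->], Hz as [Hz | ->]; auto.
    + left. apply Hx, Hy.
    + right. apply Hx, Hz.
  - intros B HBV [b Hb].
    destruct (classic (exists c : M, c ∈ A /\ c ∈ B)) as [(c & HcA & HcB) | Hno].
    + destruct (@separation (fun _ => B) (fun y => y ∈ B) A) as [D HD];
        [prove_definable|].
      destruct (HAwf D) as (m & HmD & Hm).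
      { intros y Hy. apply HD in Hy. tauto. }
      { exists c. apply HD. auto. }
      apply HD in HmD. destruct HmD as [HmA HmB].
      exists m. split; [exact HmB|]. intros y Hy.
      assert (HyV := HBV y Hy). apply HV in HyV. destruct HyV as [HyA | ->].
      * apply Hm, HD. auto.
      * apply Hx, HmA.
    + assert (HBx : forall y : M, y ∈ B -> y = x).
      { intros y Hy. assert (HyV := HBV y Hy). apply HV in HyV.
        destruct HyV as [HyA | E]; [|exact E]. destruct Hno. eauto. }
      exists b. split; [exact Hb|]. intros y Hy.
      rewrite (HBx b Hb), (HBx y Hy). exact Hxx.
  - intros y Hy S HS. apply HV in Hy. destruct Hy as [Hy | ->].
    + apply (HAG y Hy). intro z. rewrite HS, HV. split; [|tauto].
      intros [[Hz | ->] Hlt]; [auto|].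
      destruct (lt_asym HQ Hlt (proj1 (Hx y Hy))).
    + replace S with A; [exact HGx|]. apply (zf_extensionality HM).
      intro z. rewrite HS, HV. split; [auto|].
      intros [[Hz | ->] Hlt]; [exact Hz|]. destruct (proj2 Hlt). reflexivity.
Qed.

(** The union [U] of all conforming sets is itself conforming. Adjoining its chosen bound [x] gives
    another member of [K], so [x] is in [U] and strictly below itself. *)
Lemma no_strict_bound_operator (K : M) :
  (forall A : M, A ∈ K <-> conforming Q L G A) ->
  ~ (forall C : M, subset C Q -> total_on L C ->
       exists x : M, G C x /\ x ∈ Q /\ forall c : M, c ∈ C -> lt L c x).
Proof.
  intros HK HG. destruct (zf_union HM K) as [U HU].
  assert (HUconf : conforming Q L G U).
  { apply (@conforming_union K); [|exact HU]. intro A. apply HK. }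
  assert (HUconf' := HUconf). destruct HUconf' as (HUQ & HUtot & _).
  destruct (HG U HUQ HUtot) as (x & HGx & HxQ & Hx).
  destruct (adjoin U x) as [V HV].
  assert (HxU : x ∈ U).
  { apply HU. exists V. split; [|apply HV; auto].
    apply HK. exact (conforming_adjoin HUconf HGx HxQ Hx HV). }
  destruct (proj2 (Hx x HxU)). reflexivity.
Qed.

End Conforming.

Lemma choice_zorn : axiom_of_choice M -> zorn_lemma M.
Proof.
  intros HAC Q L HQ [q0 Hq0]. apply NNPP. intro Hnot.
  destruct (zf_powerset HM Q) as [PQ HPQ].
  destruct (@separation (fun _ => Q) (fun x => exists y : M, y ∈ x) PQ)
    as [X HX]; [prove_definable|].
  destruct (HAC X) as (f & [Hfpair Hf] & Hchoice).
  { intros x Hx. apply HX in Hx. tauto. }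
  assert (Hdom : forall p S x : M, is_opair p S x -> p ∈ f -> S ∈ X).
  { intros p S x Hp Hpf. destruct (Hfpair p Hpf) as (S' & x' & HS' & Hp').
    destruct (opair_inj Hp Hp') as [-> _]. exact HS'. }
  (* [x] is the value of the choice function at the set of strict upper bounds of [C]. *)
  pose (G := fun C x : M => exists S : M,
    (forall q : M, q ∈ S <-> q ∈ Q /\ forall c : M, c ∈ C -> lt L c q) /\
    rel f S x).
  (* [G], and with it [conforming], is first-order in the parameters [Q], [L] and [f]; hence the
     conforming sets form a set of the model. *)
  destruct (@separation (scons Q (scons L (fun _ => f)))
    (conforming Q L G) PQ) as [K HK].
  { unfold conforming, total_on, G. prove_definable. }
  apply (@no_strict_bound_operator Q L HQ G) with (K := K).
  - intros C x y (S & HS & Hx) (T & HT & Hy).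
    assert (E : S = T).
    { apply (zf_extensionality HM). intro q. rewrite HS, HT. tauto. }
    subst T. destruct Hx as (p & Hp & Hpf).
    assert (HSX : S ∈ X) by (apply Hdom with p x; auto).
    destruct (Hf S HSX) as (z & _ & Hz).
    rewrite <- (Hz x), <- (Hz y); [reflexivity|exact Hy|exists p; auto].
  - intro A. rewrite HK. split; [tauto|]. intro HA. split; [|exact HA].
    apply HPQ. exact (proj1 HA).
  - intros C HCQ HCtot.
    destruct (@separation (scons C (fun _ => L))
      (fun q => forall c : M, c ∈ C -> lt L c q) Q) as [S HS];
      [prove_definable|].
    (* [total_on] admits the empty set, which is not a chain; there [q0] serves as bound. *)
    assert (Hbound : exists q : M, q ∈ Q /\ forall c : M, c ∈ C -> rel L c q).
    { destruct (classic (exists c : M, c ∈ C)) as [Hne | Hempty].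
      - apply NNPP. intro Hno. apply Hnot. right. exists C.
        split; [split; [|split]|]; auto.
      - exists q0. split; [exact Hq0|]. intros c Hc. destruct Hempty. eauto. }
    destruct Hbound as (q & HqQ & Hq).
    (* Since [q] is not maximal, something lies strictly above it, and that is a strict bound of
       [C]. *)
    assert (HSne : exists r : M, r ∈ S).
    { apply NNPP. intro Hno. apply Hnot. left. exists q.
      split; [exact HqQ|]. intros (r & HrQ & Hqr). apply Hno. exists r.
      apply HS. split; [exact HrQ|]. intros c Hc. split.
      - exact (poset_trans HQ (Hq c Hc) (proj1 Hqr)).
      - intros ->. exact (lt_asym HQ Hqr (Hq r Hc)). }
    assert (HSX : S ∈ X).
    { apply HX. split; [|exact HSne]. apply HPQ. intros r Hr.
      apply HS in Hr. tauto. }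
    destruct (Hf S HSX) as (x & Hx & _).
    assert (HxS := Hchoice S x HSX Hx). apply HS in HxS.
    exists x. split; [exists S; auto|exact HxS].
Qed.

End SetTheory.

Theorem corollary2p4 (M : structure) (HM : ZF M) :
  (assertion_A M <-> zorn_lemma M) /\
  (assertion_A M <-> axiom_of_choice M) /\
  (assertion_A_some M <-> zorn_lemma M) /\
  (assertion_A_some M <-> axiom_of_choice M).
Proof.
  assert (H1 := zorn_assertion_A_some HM).
  assert (H2 := @assertion_A_some_every M).
  assert (H3 := assertion_A_zorn HM).
  assert (H4 := zorn_choice HM).
  assert (H5 := choice_zorn HM).
  tauto.
Qed.
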